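(* Let $k \ge 1$ be an integer. Every connected graph $G$ has a spanning tree $T$ such that $\gamma_k(T) = \gamma_k(G)$.
   Context: All graphs are finite, simple and undirected. For vertices $u,v$ of a graph $F$, $d_F(u,v)$ is the number of edges of a shortest $(u,v)$-path. A set $S \subseteq V(F)$ is a $k$-dominating set of a graph $F$ if every vertex of $F$ is at distance at most $k$ in $F$ from some vertex of $S$. The $k$-domination number $\gamma_k(F)$ is the minimum cardinality of a $k$-dominating set of $F$. *)

(* Defs.v *)
From mathcomp Require Import all_boot.

Set Implicit Arguments.
Unset Strict Implicit.
Unset Printing Implicit Defensive.

Record sgraph (V : finType) := SGraph {
  adj :> rel V;
  adj_sym : symmetric adj;
  adj_irrefl : irreflexive adj }.

Definition is_connected (V : finType) (G : sgraph V) : Prop :=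
  forall u v : V, connect G u v.

(* ucycle also accepts [::] and, for an edge xy, [:: x; y]; only sequences of
   at least three vertices are graph cycles. *)
Definition is_acyclic (V : finType) (G : sgraph V) : Prop :=
  forall c : seq V, ucycle G c -> size c < 3.

Definition is_tree (V : finType) (G : sgraph V) : Prop :=
  is_connected G /\ is_acyclic G.

(* T and G live on the same vertex type, so T is automatically spanning. *)
Definition is_spanning_tree (V : finType) (T G : sgraph V) : Prop :=
  subrel T G /\ is_tree T.

(* The path u :: p has size p edges. *)
Definition is_path (V : finType) (G : sgraph V) (u v : V) (p : seq V) : bool :=
  [&& path G u p, last u p == v & uniq (u :: p)].

(* No path has more than #|V| - 1 edges, so the bound #|V| loses nothing. *)
Definition path_lengths (V : finType) (G : sgraph V) (u v : V) :
    {set 'I_#|V|} :=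
  [set n : 'I_#|V| | [exists p : n.-tuple V, is_path G u v p]].

(* None stands for an infinite distance (no path from u to v). *)
Definition dist (V : finType) (G : sgraph V) (u v : V) : option nat :=
  if [pick n in path_lengths G u v] is Some n0 then
    Some (val [arg min_(n < n0 in path_lengths G u v) n])
  else None.

Definition within (V : finType) (G : sgraph V) (k : nat) (u v : V) : bool :=
  if dist G u v is Some d then d <= k else false.

Definition kdominating (V : finType) (G : sgraph V) (k : nat) (S : {set V}) :
    bool :=
  [forall v, exists u in S, within G k v u].

Lemma dist_refl (V : finType) (G : sgraph V) (u : V) : dist G u u = Some 0.
Proof.
have V0 : 0 < #|V| by apply/card_gt0P; exists u.
have P0 : Ordinal V0 \in path_lengths G u u.
  by rewrite inE; apply/existsP; exists [tuple]; rewrite /is_path /= eqxx.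
rewrite /dist; case: pickP => [n0 n0P|/(_ (Ordinal V0))]; last by rewrite P0.
case: arg_minnP => // n _ /(_ _ P0) /=.
by rewrite leqn0 => /eqP ->.
Qed.

Lemma kdominating_setT (V : finType) (G : sgraph V) (k : nat) :
  kdominating G k [set: V].
Proof.
apply/forallP => v; apply/exists_inP; exists v; first by rewrite inE.
by rewrite /within dist_refl.
Qed.

(* [set: V] is only the default of the arg min; it is always k-dominating by
   kdominating_setT, so the minimum is a genuine one. *)
Definition domination_number (V : finType) (G : sgraph V) (k : nat) : nat :=
  #|[arg min_(S < [set: V] | kdominating G k S) #|S|]|.

Notation "''gamma_' k ( G )" := (domination_number G k)
  (at level 8, k at level 2, format "''gamma_' k ( G )").

(* Main.v *)
(** Let [S] be a minimum k-dominating set of [G]. Joining each vertex outside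
    [S] to one neighbour that is nearer to [S] gives a forest in which [S] is
    still k-dominating. A forest in a connected graph extends to a spanning
    tree [T], so [S] is k-dominating in [T]; conversely, a k-dominating set of
    a spanning subgraph of [G] is one of [G]. *)

Require Import Defs.
From mathcomp Require Import all_boot.

Set Implicit Arguments.
Unset Strict Implicit.
Unset Printing Implicit Defensive.

(** * Walks, distances and domination *)

(** Shortening a walk to a path never lengthens it, so walks may replace paths here. Edges can then
    be prepended without checking for repeated vertices. *)
Lemma withinP (V : finType) (G : sgraph V) (k : nat) (u v : V) :
  reflect (exists p, [/\ path G u p, last u p = v & size p <= k])
          (within G k u v).
Proof.
rewrite /within /dist.
have short p : path G u p -> last u p = v ->
    exists2 n : 'I_#|V|, n \in path_lengths G u v & n <= size p.
  move=> Gp <-; case/shortenP: Gp => q Gq Uq sub_q.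
  have lt_q : size q < #|V|.
    by rewrite -[_.+1]/(size (u :: q)) -(card_uniqP Uq) max_card.
  exists (Ordinal lt_q) => /=; last by case/andP: Uq => _ /uniq_leq_size; apply.
  rewrite inE; apply/existsP; exists (in_tuple q).
  by rewrite /is_path Gq eqxx.
case: pickP => [n0 Pn0|no_path]; last first.
  apply: (iffP idP) => // -[p [Gp uv _]].
  by have [n] := short p Gp uv; rewrite no_path.
case: arg_minnP => // n Pn min_n; apply: (iffP idP) => [le_nk|].
  move: Pn; rewrite inE => /existsP [p /and3P [Gp /eqP uv _]].
  by exists p; rewrite size_tuple.
case=> p [Gp uv le_pk]; have [m Pm le_mp] := short p Gp uv.
exact: leq_trans (min_n m Pm) (leq_trans le_mp le_pk).
Qed.

Lemma within_subrel (V : finType) (G H : sgraph V) (k : nat) (u v : V) :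
  subrel G H -> within G k u v -> within H k u v.
Proof.
move=> sGH /withinP [p [Gp uv le_pk]]; apply/withinP; exists p.
by split=> //; apply: sub_path Gp.
Qed.

Lemma within0 (V : finType) (G : sgraph V) (u v : V) :
  within G 0 u v -> u = v.
Proof. by case/withinP=> -[|w p] []. Qed.

Lemma within_step (V : finType) (G : sgraph V) (k : nat) (u w v : V) :
  G u w -> within G k w v -> within G k.+1 u v.
Proof.
move=> Guw /withinP [p [Gp wv le_pk]].
by apply/withinP; exists (w :: p); rewrite /= Guw.
Qed.

Lemma within_first_step (V : finType) (G : sgraph V) (k : nat) (u v : V) :
  within G k.+1 u v -> u = v \/ exists2 w, G u w & within G k w v.
Proof.
case/withinP=> -[|w p] /= [Gp uv le_pk]; first by left.
case/andP: Gp => Guw Gp; right; exists w => //.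
by apply/withinP; exists p.
Qed.

Lemma kdominating_subrel (V : finType) (G H : sgraph V) (k : nat)
    (S : {set V}) :
  subrel G H -> kdominating G k S -> kdominating H k S.
Proof.
move=> sGH /forallP dom; apply/forallP => v.
have /exists_inP [u Su vu] := dom v.
by apply/exists_inP; exists u => //; apply: within_subrel vu.
Qed.

Lemma domination_number_min (V : finType) (G : sgraph V) (k : nat)
    (S : {set V}) :
  kdominating G k S -> domination_number G k <= #|S|.
Proof.
move=> domS; rewrite /domination_number.
case: arg_minnP => [|S0 _]; first exact: kdominating_setT.
exact.
Qed.

Lemma domination_number_attained (V : finType) (G : sgraph V) (k : nat) :
  exists2 S : {set V}, kdominating G k S & #|S| = domination_number G k.
Proof.
rewrite /domination_number.
by case: arg_minnP => [|S domS _]; [exact: kdominating_setT | exists S].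
Qed.

(** * Cycles, forests and spanning trees *)

(** The rest of the cycle is a detour around its closing edge. Both orientations are deleted, to
    keep the relation symmetric. *)
Lemma connect_del_cycle_edge (V : finType) (e : rel V) (x : V) (p : seq V) :
  symmetric e -> ucycle e (x :: p) -> 2 < size (x :: p) ->
  subrel e
    (connect [rel u v |
       e u v && ((u, v) \notin [set (x, last x p); (last x p, x)])]).
Proof.
move=> sym_e; set z := last x p => /andP [/=].
rewrite rcons_path => /andP [exp _] /andP [x_p Up] size_p.
set e' := [rel u v | _].
have sym_e' : symmetric e'.
  move=> u v; rewrite /= sym_e !inE !xpair_eqE orbC.
  by rewrite [(v == z) && _]andbC [(v == x) && _]andbC.
have neq_xz : x != z.
  apply: contraNneq x_p => ->; rewrite /z.
  by case: (p) size_p => //= y q _; apply: mem_last.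
have e'xz : connect e' x z.
  apply/connectP; exists p => //.
  have [y [q def_p]] : exists y q, p = y :: q.
    by case: (p) size_p => // y q; exists y, q.
  move: exp x_p Up size_p neq_xz; rewrite /e' /z def_p /=.
  move=> /andP [exy eyq] x_yq /andP [y_q _] size_q neq_xz.
  (* With at least three vertices on the cycle, the first step [x], [y] of the detour is not the
     deleted edge; the later steps avoid [x] altogether. *)
  have neq_yz : y != last y q.
    apply: contraNneq y_q => ->.
    by case: (q) size_q => //= w r _; apply: mem_last.
  rewrite exy !inE !xpair_eqE eqxx (negPf neq_yz) (negPf neq_xz) /=.
  apply: (sub_in_path (P := predC1 x)) eyq => [u v|].
    rewrite !inE /= => /negPf ux /negPf vx.
    by rewrite !inE !xpair_eqE ux vx andbF => ->.
  by apply/allP => u u_q /=; apply: contraNneq x_yq => <-.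
move=> u v euv; case: (boolP ((u, v) \in [set (x, z); (z, x)])).
  rewrite !inE !xpair_eqE => /orP [] /andP [/eqP -> /eqP ->] //.
  by rewrite (sym_connect_sym sym_e').
by move=> uv; apply: connect1; rewrite /= euv.
Qed.

Lemma acyclic_sub_spanning_tree (V : finType) (G F : sgraph V) :
  is_connected G -> subrel F G -> is_acyclic F ->
  exists2 T : sgraph V, is_spanning_tree T G & subrel F T.
Proof.
(* Take a minimal connected subgraph of [G] containing [F]: a cycle in it has
   an edge outside [F], which could be deleted. *)
move=> conG sFG acF.
(* Edge sets are finite sets of ordered pairs, so that [minset_exists] yields an inclusion-minimal
   one. *)
pose rel_of (E : {set V * V}) := [rel u v | (u, v) \in E].
pose P (E : {set V * V}) :=
  [&& [forall u, forall v, ((u, v) \in E) == ((v, u) \in E)],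
      [forall u, forall v, F u v ==> ((u, v) \in E)],
      [forall u, forall v, ((u, v) \in E) ==> G u v] &
      [forall u, forall v, connect (rel_of E) u v]].
have PG : P [set uv | G uv.1 uv.2].
  apply/and4P; split; apply/'forall_forallP => u v; rewrite ?inE /=.
  - by rewrite adj_sym.
  - by apply/implyP => /sFG.
  - by rewrite implybb.
  - by rewrite (@eq_connect _ _ G) => [|a b]; rewrite ?conG //= inE.
have [E /minsetP [PE minE] _] := minset_exists PG.
case/and4P: (PE) => /'forall_'forall_eqP symE /'forall_'forall_implyP sFE
  /'forall_'forall_implyP sEG /'forall_forallP conE.
have symT : symmetric (rel_of E) by move=> u v; apply: symE.
have irrT : irreflexive (rel_of E).
  by move=> u; apply/negP => /sEG; rewrite adj_irrefl.
exists (SGraph symT irrT); last by move=> u v /sFE.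
split; first by move=> u v /sEG.
split; first by move=> u v; apply: conE.
move=> c cyc_c; rewrite ltnNge; apply/negP => size_c.
have [cycE Uc] := andP cyc_c.
(* Otherwise [c] would be a cycle of the acyclic [F]. *)
have [x x_c nFx] : exists2 x, x \in c & ~~ F x (next c x).
  apply/exists_inP; apply: contraTT size_c; rewrite negb_exists_in => FcP.
  rewrite -ltnNge; apply: acF; rewrite /ucycle Uc andbT.
  apply: cycle_from_next => // x x_c.
  by have /forall_inP/(_ x x_c) := FcP; rewrite negbK.
have y_c : next c x \in c by rewrite mem_next.
(* Rotate the cycle so that the edge outside [F] becomes its closing edge. *)
have [i q rot_c] := rot_to y_c.
have last_q : last (next c x) q = x.
  have prev_y : prev (rot i c) (next c x) = x by rewrite prev_rot // prev_next.
  have /andP [y_q _] : uniq (next c x :: q).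
    by rewrite -rot_c rot_uniq.
  (* The predecessor of the head is read at the index of the head in [q]; as the head does not recur
     there, this is the last position. *)
  have := prev_nth (next c x :: q) (next c x).
  rewrite mem_head -rot_c prev_y rot_c => {2}->.
  by rewrite memNindex // -[size q]/(size (next c x :: q)).-1 nth_last.
have cyc_yq : ucycle (rel_of E) (next c x :: q).
  by rewrite -rot_c /ucycle rot_cycle cycE rot_uniq.
have size_yq : 2 < size (next c x :: q) by rewrite -rot_c size_rot.
have := connect_del_cycle_edge symT cyc_yq size_yq.
rewrite last_q; set y := next c x; set D := [set _; _] => conD.
have /minE sub : P (E :\: D).
  have symD u v : ((u, v) \in D) = ((v, u) \in D).
    rewrite !inE !xpair_eqE orbC.
    by rewrite [(v == x) && _]andbC [(v == y) && _]andbC.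
  apply/and4P; split; apply/'forall_forallP => u v.
  - by rewrite !(in_setD) symE symD.
  - apply/implyP => Fuv; rewrite in_setD sFE // andbT.
    apply: contra nFx; rewrite !inE !xpair_eqE -/y.
    by case/orP=> /andP [/eqP <- /eqP <-] //; rewrite adj_sym.
  - by apply/implyP => /setDP [/sEG].
  (* Each edge of a path in [E] is replaced by a path avoiding [D]. *)
  - have := conE u v; apply: connect_sub => a b /conD.
    by apply: connect_sub => {}a {}b ab; rewrite connect1 //= in_setD andbC.
have : (x, y) \in E by apply: next_cycle cycE x_c.
by rewrite -sub ?subsetDl // in_setD !inE eqxx orbT.
Qed.

Lemma parent_forest_acyclic (V : finType) (F : sgraph V) (d : V -> nat)
    (par : V -> V) :
  (forall u v, F u v ->
     (d v < d u /\ v = par u) \/ (d u < d v /\ u = par v)) ->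
  is_acyclic F.
Proof.
(* Both neighbours on the cycle of a vertex maximizing [d] are its parent. *)
move=> FP [//|x0 c0]; set c := x0 :: c0 => /andP [cycF Uc].
rewrite ltnNge; apply/negP => size_c.
pose x := [arg max_(x > x0 in c) d x].
have [x_c max_x] : x \in c /\ forall y, y \in c -> d y <= d x.
  by rewrite /x; case: arg_maxnP => [|x' x'_c]; [exact: mem_head | split].
have par_nb y : y \in c -> F x y -> y = par x.
  move=> y_c /FP [[]|[]] //.
  by rewrite ltnNge max_x.
have next_prev_x : next c x = prev c x.
  rewrite (par_nb (next c x)) ?mem_next ?next_cycle //.
  by rewrite -(par_nb (prev c x)) ?mem_prev // adj_sym prev_cycle.
have next_next_x : next c (next c x) = x.
  by rewrite next_prev_x next_prev.
(* With [x] rotated to the front, two steps returning to [x] contradict having at least three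
   distinct vertices. *)
have [i p rot_c] := rot_to x_c.
move: size_c next_next_x; rewrite -!(next_rot i Uc).
move: Uc; rewrite -(rot_uniq i) -(size_rot i) rot_c.
case: p {rot_c} => [|y [|z p]] //= Ux _.
move: Ux; rewrite !inE !eqxx eq_sym; case: eqP => //= _.
by case: eqVneq => // neq_xz _ z_x; rewrite z_x eqxx in neq_xz.
Qed.

(** * A spanning tree that keeps [S] dominating *)

Lemma kdominating_spanning_tree (V : finType) (G : sgraph V) (k : nat)
    (S : {set V}) :
  is_connected G -> kdominating G k S ->
  exists2 T : sgraph V, is_spanning_tree T G & kdominating T k S.
Proof.
move=> conG domS.
pose near n v := [exists u in S, within G n v u].
have near_k v : exists n, near n v by exists k; apply: (forallP domS).
(* [d v] is the distance from [v] to [S] in [G], finite because [S] is k-dominating. *)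
have [d near_d d_min] :
    exists2 d, forall v, near (d v) v & forall n v, near n v -> d v <= n.
  exists (fun v => ex_minn (near_k v)) => [v|n v nv]; case: ex_minnP => //.
  by move=> m _; apply.
(* The second vertex of a shortest path from [v] to [S] is a nearer neighbour. The default [v] is
   taken only when [d v] is 0. *)
have [par parP] :
    exists par, forall v, 0 < d v -> G v (par v) && (d (par v) < d v).
  exists (fun v => odflt v [pick w | G v w && (d w < d v)]) => v d_gt0.
  case: pickP => //= no_par.
  have /exists_inP [u Su vu] := near_d v.
  case def_d: (d v) d_gt0 vu => [//|n] _ /within_first_step [v_u|[w Gvw wu]].
    have : near 0 v.
      apply/exists_inP; exists u => //; rewrite v_u.
      by apply/withinP; exists [::].
    by move/d_min; rewrite def_d.
  have /d_min le_dw : near n w by apply/exists_inP; exists u.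
  by have := no_par w; rewrite Gvw def_d ltnS le_dw.
(* The guards leave the vertices of [S], where [d] vanishes and [parP] says nothing, without a
   parent edge. *)
pose f u v := (0 < d u) && (v == par u) || (0 < d v) && (u == par v).
have sfG : subrel f G.
  move=> u v /orP [] /andP [/parP /andP [Gp _] /eqP ->] //.
  by rewrite adj_sym.
have sym_f : symmetric f by move=> u v; rewrite /f orbC.
have irr_f : irreflexive f.
  by move=> u; apply/negP => /sfG; rewrite adj_irrefl.
have acF : is_acyclic (SGraph sym_f irr_f).
  apply: (@parent_forest_acyclic _ _ d par) => u v /orP [] /andP [].
    by move=> /parP /andP [_ lt_d] /eqP ->; left.
  by move=> /parP /andP [_ lt_d] /eqP ->; right.
have [|T spanT sFT] := acyclic_sub_spanning_tree conG _ acF; first exact: sfG.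
exists T => //; apply/forallP => v.
have : d v <= k by apply: d_min; apply: (forallP domS).
(* Following parents from [v] reaches [S] after at most [d v] edges of [T], by induction on a bound
   for [d v]. *)
suff dominated n : d v <= n -> [exists u in S, within T n v u].
  exact: dominated.
elim: n v => [|n IHn] v le_d; have [d0|d_gt0] := posnP (d v);
  try by have /exists_inP [u Su] := near_d v; rewrite d0 => /within0 v_u;
    apply/exists_inP; exists u => //; apply/withinP; exists [::].
  by rewrite leqNgt d_gt0 in le_d.
have /andP [_ lt_d] := parP v d_gt0.
have /exists_inP [u Su vu] := IHn (par v) (leq_trans lt_d le_d).
apply/exists_inP; exists u => //; apply: within_step vu.
by apply: sFT; rewrite /= /f d_gt0 eqxx.
Qed.

Theorem lemma5 (k : nat) (hk : 1 <= k) (V : finType) (G : sgraph V)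
    (hG : is_connected G) :
  exists T : sgraph V, is_spanning_tree T G /\ 'gamma_k(T) = 'gamma_k(G).
Proof.
have [S domS cardS] := domination_number_attained G k.
have [T spanT domT] := kdominating_spanning_tree hG domS.
exists T; split; first exact: spanT.
apply: anti_leq; apply/andP; split.
  by rewrite -cardS; apply: domination_number_min.
have [S' domS' <-] := domination_number_attained T k.
by apply: domination_number_min; apply: kdominating_subrel domS'; case: spanT.
Qed.
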